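(* Every affine equivariant integrator map $\phi$ is closed under differentiation: for every Banach space $Y$ and every $f\in\mathfrak{X}(Y)$, $\phi(\delta f)=\delta\phi(f)$.
   Context: All spaces are real Banach spaces; $\mathfrak{X}(Y)$ denotes the smooth vector fields on $Y$. An integrator map $\phi$ is a collection of smooth maps $\phi_Y\colon\mathfrak{X}(Y)\to\mathfrak{X}(Y)$, one for each Banach space $Y$. For Gâteaux differentiable $\chi\colon Y\to U$, $f\sim_\chi g$ means $\chi'(y)f(y)=g(\chi(y))$ for all $y$. $\phi$ is affine equivariant if for every affine $A\colon Y\to U$ between Banach spaces, $f\sim_A g$ implies $\phi(f)\sim_A\phi(g)$. For $f\in\mathfrak X(Y)$, the tangent lift $\delta f\in\mathfrak X(Y\times Y)$ is $\delta f(y,\eta)=(f(y),f'(y)\eta)$. *)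

(* Defs.v *)
From mathcomp Require Import all_boot all_algebra.
From mathcomp Require Import all_classical all_reals all_analysis.
Set Implicit Arguments. Unset Strict Implicit. Unset Printing Implicit Defensive.
Import GRing.Theory Num.Theory.
Local Open Scope ring_scope.
Local Open Scope classical_set_scope.

Definition banach (R : realType) (Y : normedModType R) : Prop :=
  forall F : set_system Y, ProperFilter F -> cauchy F -> cvg F.

(* C^n in the Michal-Bastiani sense: C^0 = continuous; C^{n+1} = all
   directional derivatives exist and (x,v) |-> f'(x)v is C^n on U x U.
   On Banach spaces C^oo in this sense coincides with Frechet C^oo. *)
Fixpoint smooth_n (R : realType) (n : nat) (U V : normedModType R)
    (f : U -> V) {struct n} : Prop :=
  match n with
  | O => continuous f
  | S m => (forall x v : U, derivable f x v) /\
           @smooth_n R m (U * U)%type V (fun p : U * U => 'D_(p.2) f p.1)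
  end.

Definition smooth (R : realType) (U V : normedModType R) (f : U -> V) : Prop :=
  forall n, smooth_n n f.

Definition related (R : realType) (Y U : normedModType R)
    (chi : Y -> U) (f : Y -> Y) (g : U -> U) : Prop :=
  forall y, 'D_(f y) chi y = g (chi y).

Definition affine_map (R : realType) (Y U : normedModType R) (A : Y -> U) : Prop :=
  exists (L : Y -> U) (b : U),
    (forall (a : R) (x y : Y), L (a *: x + y) = a *: L x + L y) /\
    continuous L /\ (forall y, A y = L y + b).

(* A candidate integrator map: one map phi Y on vector fields for each
   space; only its values on smooth vector fields of Banach spaces matter. *)
Definition int_map (R : realType) :=
  forall Y : normedModType R, (Y -> Y) -> (Y -> Y).

(* phi_Y maps X(Y) to X(Y) and is smooth (convenient calculus: smooth
   curves t |-> g_t in X(Y), i.e. smooth g : R x Y -> Y, are mapped to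
   smooth curves t |-> phi(g_t)). *)
Definition integrator_map (R : realType) (phi : int_map R) : Prop :=
  forall Y : normedModType R, banach Y ->
    (forall f : Y -> Y, smooth f -> smooth (phi Y f)) /\
    (forall g : (R * Y)%type -> Y, smooth g ->
       smooth (fun p : (R * Y)%type => phi Y (fun y => g (p.1, y)) p.2)).

Definition affine_equivariant (R : realType) (phi : int_map R) : Prop :=
  forall (Y U : normedModType R), banach Y -> banach U ->
  forall (A : Y -> U) (f : Y -> Y) (g : U -> U),
    affine_map A -> smooth f -> smooth g ->
    related A f g -> related A (phi Y f) (phi U g).

Definition tangent_lift (R : realType) (Y : normedModType R) (f : Y -> Y)
    : (Y * Y)%type -> (Y * Y)%type :=
  fun p => (f p.1, 'D_(p.2) f p.1).

(* Main.v *)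
(** For [t <> 0] the linear map [(y, eta) |-> t eta + y] intertwines [f] with
    the field [g_t (y, eta) = (f y, (f (t eta + y) - f y) / t)], and so does
    the first projection. Hence equivariance forces
    [phi (g_t) (y, eta) = (phi f y, (phi f (t eta + y) - phi f y) / t)], which
    tends to [tangent_lift (phi f)] as [t] goes to [0]. Writing the quotient as
    the integral of [f' (y + s t eta) eta] over [s] in [[0, 1]] shows that
    [g_t] extends to a smooth family with [g_0 = tangent_lift f], so
    [phi (g_t)] also tends to [phi (tangent_lift f)]. The integral is a limit
    of Riemann sums, and its smoothness in the parameters rests on the mean
    value inequality. *)

Require Import Defs.
From mathcomp Require Import all_boot all_order all_algebra.
From mathcomp Require Import all_classical all_reals all_analysis.
From mathcomp Require Import ring lra.

Set Implicit Arguments.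
Unset Strict Implicit.
Unset Printing Implicit Defensive.

Import Order.TTheory GRing.Theory Num.Theory.
Import numFieldNormedType.Exports.

Local Open Scope ring_scope.
Local Open Scope classical_set_scope.

(** * Directional derivatives as first-order expansions *)

Section DirectionalDerivative.
Variables (R : realType) (U V : normedModType R).
Implicit Types (f : U -> V) (x v : U) (l : V).

Lemma is_deriveP f x v l :
  is_derive x v f l <->
  h^-1 *: (f (h *: v + x) - f x) @[h --> 0^'] --> l.
Proof.
split=> [[df <-]|cf]; first exact: df.
by split; [apply/cvg_ex; exists l | exact: cvg_lim cf].
Qed.

(** Multiplying the quotient by [h] makes the estimate trivial at [h = 0], so it ranges over a full
    neighbourhood and involves no division. It is the form that the mean value inequality
    delivers. *)
Lemma is_derive_distP f x v l :
  is_derive x v f l <->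
  forall e : R, 0 < e ->
    \forall h \near (0 : R), `|f (h *: v + x) - f x - h *: l| <= e * `|h|.
Proof.
split=> [/is_deriveP/cvgrPdist_le cf e e0|cf].
  have := cf _ e0; rewrite near_withinE; apply: filterS => h.
  have [->|h0 /(_ isT)] := eqVneq h 0.
    by move=> _; rewrite !scale0r add0r subrr subr0 !normr0 mulr0.
  rewrite distrC => hle.
  have -> : f (h *: v + x) - f x - h *: l =
      h *: (h^-1 *: (f (h *: v + x) - f x) - l).
    by rewrite scalerBr scalerA divff // scale1r.
  by rewrite normrZ mulrC ler_wpM2r.
apply/is_deriveP/cvgrPdist_le => e e0.
rewrite near_withinE; apply: filterS (cf _ e0) => h hle h0.
have -> : l - h^-1 *: (f (h *: v + x) - f x) =
    - (h^-1 *: (f (h *: v + x) - f x - h *: l)).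
  by rewrite [in RHS]scalerBr scalerA mulVf // scale1r opprB.
by rewrite normrN normrZ normfV mulrC ler_pdivrMr ?normr_gt0.
Qed.

(** The estimate for [v] is used at [h * a]. Dividing by [|a| + 1] instead of [|a|] covers
    [a = 0]. *)
Lemma is_derive_dirZ f x v l (a : R) :
  is_derive x v f l -> is_derive x (a *: v) f (a *: l).
Proof.
move=> /is_derive_distP df; apply/is_derive_distP => e e0.
have a0 : 0 < `|a| + 1 by rewrite ltr_wpDl.
have /nbhs_norm0P[d /= d0 dfd] := df _ (divr_gt0 e0 a0).
apply/nbhs_norm0P; exists (d / (`|a| + 1)) => /=; first exact: divr_gt0.
move=> h /=; rewrite ltr_pdivlMr // => hd.
have /= := dfd (h * a); rewrite normrM -!scalerA => dha.
apply: le_trans (dha _) _.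
  by apply: le_lt_trans hd; rewrite ler_wpM2l // lerDl.
rewrite mulrAC mulrA ler_pdivrMr // -mulrA -[leRHS]mulrA ler_wpM2l //; first exact: ltW.
by rewrite ler_wpM2l // lerDl.
Qed.

End DirectionalDerivative.

Lemma is_derive_line (R : realType) (U V : normedModType R) (f : U -> V) (x v : U) (s : R) :
  derivable f (s *: v + x) v ->
  is_derive s 1 (fun r : R => f (r *: v + x)) ('D_v f (s *: v + x)).
Proof.
move=> /derivableP/is_derive_distP df; apply/is_derive_distP => e e0.
apply: filterS (df e e0) => h.
by rewrite addrA -scalerDl [h *: 1]mulr1.
Qed.

(** * Mean value inequalities for curves and along segments *)

Section MeanValue.
Variables (R : realType) (V : normedModType R).

(** A vector-valued curve need not attain its mean slope, so the bound is proved for every slope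
    [M + e], whose slack absorbs the first-order error. *)
Lemma curve_mean_value (c : R -> V) (M : R) :
  (forall t, derivable c t 1) ->
  (forall t, 0 <= t <= 1 -> `|'D_1 c t| <= M) ->
  `|c 1 - c 0| <= M.
Proof.
move=> dc cM; apply/ler_addgt0Pr => e e0.
have M0 : 0 <= M by apply: le_trans (normr_ge0 _) (cM 0 _); rewrite lexx ler01.
(* [T] is the end of the maximal interval on which [P] holds; differentiability
   of [c] at [T] pushes [P] up to [T] and, if [T < 1], beyond. *)
pose P s := `|c s - c 0| <= (M + e) * s.
pose A := [set t : R | 0 <= t <= 1 /\ forall s, 0 <= s <= t -> P s].
have P0 : P 0 by rewrite /P subrr normr0 mulr0.
have A0 : A 0.
  by split=> [|s]; [rewrite lexx ler01 | rewrite -eq_le => /eqP <-].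
have supA : has_sup A.
  by split; [exists 0 | exists 1 => t [/andP[]]].
pose T := sup A.
have T0 : 0 <= T by apply: ub_le_sup A0; exact: supA.2.
have T1 : T <= 1 by apply: ge_sup; [exists 0 | move=> t [/andP[]]].
have /is_derive_distP/(_ _ e0)/nbhs_norm0P[d /= d0 dcT] :=
  derivableP (dc T).
have near_T s : `|s - T| < d -> `|c s - c T| <= (M + e) * `|s - T|.
  move=> sTd; have /= := dcT _ sTd; rewrite [_ *: 1]mulr1 subrK => h.
  have -> : c s - c T = (c s - c T - (s - T) *: 'D_1 c T) + (s - T) *: 'D_1 c T.
    by rewrite subrK.
  apply: le_trans (ler_normD _ _) _; rewrite normrZ.
  have : `|s - T| * `|'D_1 c T| <= `|s - T| * M.
    by rewrite ler_wpM2l // cM // T0 T1.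
  by move: h; lra.
have PT : P T.
  have [t [/andP[t0 t1] At] tT] : exists2 t, A t & T - d < t.
    by have [t ? ?] := sup_adherent d0 supA; exists t.
  have tleT : t <= T by apply: ub_le_sup; [exact: supA.2 | split=> //; rewrite t0].
  have := near_T t; rewrite ler0_norm ?subr_le0 // => /(_ _) h.
  have {}h : `|c t - c T| <= (M + e) * - (t - T) by apply: h; lra.
  have := At t; rewrite lexx t0 => /(_ isT); rewrite /P => Pt.
  have -> : c T - c 0 = (c t - c 0) - (c t - c T).
    by rewrite opprB [RHS]addrC addrA subrK.
  apply: le_trans (ler_normB _ _) _; move: h Pt; lra.
have Plt s : 0 <= s -> s < T -> P s.
  move=> s0 sT; have Ts : 0 < T - s by rewrite subr_gt0.
  have [t [_ At] st] := sup_adherent Ts supA.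
  by apply: At; rewrite s0; move: st; rewrite -/T; lra.
have [TE|TN1] := eqVneq T 1; last first.
  have Tlt1 : T < 1 by rewrite lt_neqAle TN1.
  (* Halving [d] keeps [[T, t']] inside the open radius of [near_T]. The cap at 1 keeps [t']
     admissible for [A], and [T < t'] contradicts the choice of [T]. *)
  pose t' := Num.min 1 (T + d / 2).
  have [t'1 t'T t'd] : [/\ t' <= 1, T < t' & t' < T + d].
    by rewrite /t'; case: (ltP 1 (T + d / 2)) => ?; split; lra.
  suff At' : A t' by have := ub_le_sup supA.2 At'; rewrite -/T; lra.
  split=> [|s /andP[s0 st]]; first by rewrite t'1 andbT; lra.
  have [sT|Ts] := ltP s T; first exact: Plt.
  have := near_T s; rewrite ger0_norm ?subr_ge0 // => /(_ _) h.
  have {}h : `|c s - c T| <= (M + e) * (s - T) by apply: h; lra.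
  move: PT; rewrite /P => PT.
  have -> : c s - c 0 = (c s - c T) + (c T - c 0) by rewrite addrA subrK.
  apply: le_trans (ler_normD _ _) _; move: h PT; lra.
by move: PT; rewrite /P TE mulr1.
Qed.

End MeanValue.

Section Segment.
Variables (R : realType) (U V : normedModType R).
Implicit Types (f : U -> V).

(** The curve [s |-> f (s v + x) - s w] has derivative ['D_v f - w], so the curve inequality bounds
    its total increment. *)
Lemma segment_mean_value f (x v : U) (w : V) (M : R) :
  (forall y, derivable f y v) ->
  (forall s : R, 0 <= s <= 1 -> `|'D_v f (s *: v + x) - w| <= M) ->
  `|f (v + x) - f x - w| <= M.
Proof.
move=> df fM; pose c (s : R) := f (s *: v + x) - s *: w.
have dc (s : R) : is_derive s (1 : R) c ('D_v f (s *: v + x) - w).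
  apply/is_derive_distP => e e0.
  have /is_derive_distP/(_ _ e0) := is_derive_line (df (s *: v + x)).
  apply: filterS => h; rewrite /c [h *: 1]mulr1 => hle.
  rewrite [(h + s) *: w]scalerDl scalerBr.
  have abel (a a' b b' d : V) : a - (b + b') - (a' - b') - (d - b) = a - a' - d.
    by rewrite opprD !opprB !addrA subrK (addrAC _ (- a')) subrK.
  by rewrite abel.
have := @curve_mean_value R V c M (fun t => @ex_derive _ _ _ _ _ _ _ (dc t)).
rewrite /c !scale1r !scale0r add0r subr0 addrAC; apply => t t01.
by rewrite (@derive_val _ _ _ _ _ _ _ (dc t)); exact: fM.
Qed.

(** Homogeneity of the derivative in its direction yields the factor [|t|], so the bound has the
    shape required by [is_derive_distP]. *)
Lemma segment_mean_valueZ f (x u : U) (w : V) (t M : R) :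
  (forall y, derivable f y u) ->
  (forall s : R, 0 <= s <= 1 -> `|'D_u f (s *: (t *: u) + x) - w| <= M) ->
  `|f (t *: u + x) - f x - t *: w| <= M * `|t|.
Proof.
move=> df fM; have dfZ y := is_derive_dirZ t (derivableP (df y)).
apply: segment_mean_value => [y|s s01]; first exact: ex_derive.
rewrite (@derive_val _ _ _ _ _ _ _ (dfZ _)) -scalerBr normrZ mulrC ler_wpM2r //.
exact: fM.
Qed.

(** The derivative vanishes at [(x, 0)]. Joint continuity there makes the derivative along [y - x]
    small on the whole segment from [x] to [y], and the mean value inequality concludes. *)
Lemma smooth1_continuous f :
  (forall x v, derivable f x v) ->
  continuous (fun p : (U * U)%type => 'D_(p.2) f p.1) -> continuous f.
Proof.
move=> df cf x; apply/cvgrPdist_le => e e0.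
have f0 : 'D_0 f x = 0.
  by have := @derive_val _ _ _ _ _ _ _ (is_derive_dirZ 0 (derivableP (df x 0)));
     rewrite !scale0r.
have /cvgrPdist_le/(_ _ e0) := cf (x, 0).
move=> /nbhs_normP[d /= d0 cfd].
apply/nbhs_normP; exists d => //= y /= xyd.
rewrite distrC.
have := @segment_mean_value f x (y - x) 0 e (fun z => df z _).
rewrite subrK subr0; apply => s /andP[s0 s1].
have /= := cfd (s *: (y - x) + x, y - x); rewrite f0 sub0r normrN subr0; apply.
rewrite prod_normE /= gt_max.
rewrite sub0r normrN opprD addrCA subrr addr0 normrN distrC xyd andbT.
rewrite normrZ ger0_norm // distrC; apply: le_lt_trans xyd.
by rewrite ler_piMl.
Qed.

End Segment.

(* Only directional derivatives are available, hence no Frechet remainder: the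
   increment of [g] is [h u] with [u] close to [l], and the mean value inequality
   compares [f (h u + g x) - f (g x)] with [h 'D_l f (g x)]. *)
Lemma is_derive_comp (R : realType) (U V W : normedModType R)
    (g : U -> V) (f : V -> W) (x v : U) (l : V) :
  is_derive x v g l -> (forall y u, derivable f y u) ->
  continuous (fun p : (V * V)%type => 'D_(p.2) f p.1) ->
  is_derive x v (f \o g) ('D_l f (g x)).
Proof.
move=> dg df cf; apply/is_derive_distP => e e0.
have /cvgrPdist_le/(_ _ e0)/nbhs_normP[d /= d0 cfd] := cf (g x, l).
have /is_deriveP/cvgrPdist_lt/(_ _ d0) := dg.
rewrite near_withinE => dgd.
(* Since [|u| <= |l| + d], an [h] below this radius keeps [h u] of norm less than [d]. *)
have l0 : 0 < d / (`|l| + d) by rewrite divr_gt0 // ltr_wpDl.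
near=> h; have [->|h0] := eqVneq h 0.
  by rewrite /= !scale0r add0r subrr subr0 !normr0 mulr0.
pose u := h^-1 *: (g (h *: v + x) - g x).
have lu : `|l - u| < d by apply: (near dgd h).
have gE : g (h *: v + x) = h *: u + g x.
  by rewrite /u scalerA divff // scale1r subrK.
rewrite /= gE; move: u lu gE => u lu _; apply: segment_mean_valueZ => // s /andP[s0 s1].
rewrite distrC; apply: (cfd (_, u)) => /=.
rewrite prod_normE /= gt_max lu andbT opprD addrCA subrr addr0 normrN.
rewrite 2!normrZ (ger0_norm s0); apply: (@le_lt_trans _ _ (`|h| * (`|l| + d))).
  have ul : `|u| <= `|l| + d.
    rewrite -(subrK l u); apply: le_trans (ler_normD _ _) _.
    by rewrite addrC lerD2l distrC ltW.
  apply: (@le_trans _ _ (`|h| * `|u|)); first by rewrite ler_piMl // mulr_ge0.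
  by rewrite ler_wpM2l.
rewrite -ltr_pdivlMr ?ltr_wpDl //; near: h; exact: nbhs0_lt.
Unshelve. all: by end_near. Qed.

(** * Calculus of [smooth_n] maps *)

Section SmoothCalculus.
Variable R : realType.
Implicit Types (U V W : normedModType R) (n : nat).

(** Allows an explicit formula [f1] for the derivative in the inductions on [n] below. *)
Lemma smooth_nS U V n (f : U -> V) (f1 : (U * U)%type -> V) :
  (forall x v, is_derive x v f (f1 (x, v))) -> smooth_n n f1 ->
  smooth_n n.+1 f.
Proof.
move=> df sf1; split=> [x v|]; first exact: ex_derive.
suff -> : (fun p : (U * U)%type => 'D_(p.2) f p.1) = f1 by [].
by apply/funext => -[x v]; exact: derive_val.
Qed.

Lemma smooth_n_continuous U V n (f : U -> V) : smooth_n n f -> continuous f.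
Proof.
elim: n U V f => [//|n IHn] U V f [df /IHn]; exact: smooth1_continuous.
Qed.

Lemma smooth_nW U V n (f : U -> V) : smooth_n n.+1 f -> smooth_n n f.
Proof.
elim: n U V f => [|n IHn] U V f; first exact: smooth_n_continuous.
by move=> [df sf]; split=> //; exact: IHn.
Qed.

Lemma is_derive_linear U V (L : U -> V) (b : V) (x v : U) :
  (forall (a : R) (y z : U), L (a *: y + z) = a *: L y + L z) ->
  is_derive x v (fun y => L y + b) (L v).
Proof.
move=> linL; apply/is_derive_distP => e e0; near=> h.
rewrite linL -(addrA _ (L x)) addrK subrr normr0.
by rewrite mulr_ge0 // ltW.
Unshelve. all: by end_near. Qed.

(** The derivative [(x, v) |-> L v] is again affine, now on [U * U], so induction over all spaces
    closes. *)
Lemma smooth_n_affine U V n (A : U -> V) : affine_map A -> smooth_n n A.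
Proof.
elim: n U V A => [|n IHn] U V A [L [b [linL [cL AE]]]].
  have -> : A = fun y => L y + b by apply/funext.
  by move=> x; apply: cvgD; [exact: cL | exact: cst_continuous].
have -> : A = fun y => L y + b by apply/funext.
apply: (@smooth_nS _ _ _ _ (fun p => L p.2)) => [x v|].
  exact: is_derive_linear.
apply: IHn; exists (fun p => L p.2), 0; split; first by move=> a x y /=.
split=> [p|p]; last by rewrite addr0.
by apply: continuous_comp; [exact: cvg_snd | exact: cL].
Qed.

Lemma smooth_n_fst U V n : smooth_n n (@fst U V).
Proof.
apply: smooth_n_affine; exists fst, 0; split=> //; split=> [p|p].
  exact: cvg_fst.
by rewrite addr0.
Qed.

Lemma smooth_n_snd U V n : smooth_n n (@snd U V).
Proof.
apply: smooth_n_affine; exists snd, 0; split=> //; split=> [p|p].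
  exact: cvg_snd.
by rewrite addr0.
Qed.

Lemma smooth_n_cst U V n (b : V) : smooth_n n (fun _ : U => b).
Proof.
apply: smooth_n_affine; exists (fun=> 0), b; split=> [a _ _|].
  by rewrite scaler0 addr0.
by split=> [x|x]; [exact: cst_continuous | rewrite add0r].
Qed.

Lemma is_derive_pair U V W (f : U -> V) (g : U -> W) (x v : U) (l : V) (m : W) :
  is_derive x v f l -> is_derive x v g m ->
  is_derive x v (fun y => (f y, g y)) (l, m).
Proof.
move=> /is_derive_distP df /is_derive_distP dg; apply/is_derive_distP => e e0.
apply: filterS2 (df _ e0) (dg _ e0) => h hf hg.
by rewrite prod_normE /= ge_max hf hg.
Qed.

Lemma smooth_n_pair U V W n (f : U -> V) (g : U -> W) :
  smooth_n n f -> smooth_n n g -> smooth_n n (fun x => (f x, g x)).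
Proof.
elim: n U V W f g => [|n IHn] U V W f g.
  by move=> cf cg x; apply: cvg_pair; [exact: cf | exact: cg].
move=> [df sf] [dg sg].
apply: (@smooth_nS _ _ _ _ (fun p => ('D_(p.2) f p.1, 'D_(p.2) g p.1))).
  by move=> x v; apply: is_derive_pair; exact: derivableP.
exact: IHn.
Qed.

(** The derivative of the composite is the derivative of [g] composed with
    [(x, v) |-> (f x, 'D_v f x)]. This is a composite of two maps of order [n], to which the
    induction hypothesis applies. *)
Lemma smooth_n_comp U V W n (f : U -> V) (g : V -> W) :
  smooth_n n f -> smooth_n n g -> smooth_n n (fun x => g (f x)).
Proof.
elim: n U V W f g => [|n IHn] U V W f g.
  by move=> cf cg x; apply: continuous_comp; [exact: cf | exact: cg].
move=> sf [dg sg]; have [df sf1] := sf.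
apply: (@smooth_nS _ _ _ _
    (fun p : (U * U)%type => 'D_('D_(p.2) f p.1) g (f p.1))) => [x v|].
  apply: (is_derive_comp (derivableP (df x v)) dg).
  exact: smooth_n_continuous sg.
apply: (IHn _ _ _ (fun p : (U * U)%type => (f p.1, 'D_(p.2) f p.1)) _ _ sg).
apply: smooth_n_pair => //.
by apply: IHn (smooth_nW sf); exact: smooth_n_fst.
Qed.

Lemma smooth_n_add U V n (f g : U -> V) :
  smooth_n n f -> smooth_n n g -> smooth_n n (fun x => f x + g x).
Proof.
move=> sf sg; apply: (smooth_n_comp (smooth_n_pair sf sg)
  (g := fun p : (V * V)%type => p.1 + p.2)).
apply: smooth_n_affine; exists (fun p => p.1 + p.2), 0; split=> [a p q|] /=.
  by rewrite scalerDr addrACA.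
by split=> [p|p]; [exact: add_continuous | rewrite addr0].
Qed.

Lemma is_derive_scale U V (a : U -> R) (f : U -> V) (x v : U) (k : R) (l : V) :
  is_derive x v a k -> is_derive x v f l ->
  is_derive x v (fun y => a y *: f y) (a x *: l + k *: f x).
Proof.
move=> /is_deriveP da /is_deriveP df; apply/is_deriveP.
(* Differentiability along [v] gives continuity of [a] along the line [h v + x], which suffices for
   the product rule. *)
have ca : a (h *: v + x) @[h --> (0 : R)^'] --> a x.
  have -> : a x = a x + 0 * k by rewrite mul0r addr0.
  have ch : (h : R) @[h --> (0 : R)^'] --> (0 : R) by exact: cvg_within.
  apply: (cvg_trans _ (cvgD (cvg_cst (a x)) (cvgM ch da))).
  apply: near_eq_cvg; rewrite near_withinE; apply: nearW => h h0 /=.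
  rewrite -[LHS]/(a x + h * (h^-1 * (a (h *: v + x) - a x))).
  by rewrite mulrA divff // mul1r addrC subrK.
apply: (cvg_trans _ (cvgD (cvgZ ca df) (cvgZ da (cvg_cst (f x))))).
apply: near_eq_cvg; apply: nearW => h /=.
rewrite -[LHS]/(a (h *: v + x) *: (h^-1 *: (f (h *: v + x) - f x)) +
  (h^-1 * (a (h *: v + x) - a x)) *: f x).
rewrite scalerA mulrC -!scalerA -scalerDr; congr (_ *: _).
by rewrite scalerBr scalerBl addrA subrK.
Qed.

Lemma smooth_n_scale U V n (a : U -> R) (f : U -> V) :
  smooth_n n a -> smooth_n n f -> smooth_n n (fun x => a x *: f x).
Proof.
elim: n U V a f => [|n IHn] U V a f.
  by move=> ca cf x; apply: cvgZ; [exact: ca | exact: cf].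
move=> sa sf; have [da sa1] := sa; have [df sf1] := sf.
apply: (@smooth_nS _ _ _ _
  (fun p => a p.1 *: 'D_(p.2) f p.1 + 'D_(p.2) a p.1 *: f p.1)) => [x v|].
  by apply: is_derive_scale; exact: derivableP.
apply: smooth_n_add; apply: IHn => //.
  exact: smooth_n_comp (smooth_n_fst _ _ _) (smooth_nW sa).
exact: smooth_n_comp (smooth_n_fst _ _ _) (smooth_nW sf).
Qed.

End SmoothCalculus.

(** * Riemann integrals of vector-valued curves over [[0, 1]] *)

Section RiemannIntegral.
Variable R : realType.
Implicit Types (E V : normedModType R).

Lemma continuous_slice E V (h : (R * E)%type -> V) (x : E) :
  continuous h -> continuous (fun s : R => h (s, x)).
Proof.
move=> ch s; apply: (continuous_comp (f := fun s : R => (s, x))); last exact: ch.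
apply: (@smooth_n_pair R R R E 0 id (fun=> x)) s => s; first exact: cvg_id.
exact: cst_continuous.
Qed.

(** A tube lemma: by compactness of [[0, 1]], finitely many of the neighbourhoods given by
    continuity at the points [(s, x0)] suffice. *)
Lemma uniform_near_segment E V (h : (R * E)%type -> V) (x0 : E) (e : R) :
  continuous h -> 0 < e ->
  \forall x \near x0, forall s, 0 <= s <= 1 -> `|h (s, x) - h (s, x0)| <= e.
Proof.
move=> ch e0.
have e20 : 0 < e / 2 by rewrite divr_gt0.
pose P x s := `|h (s, x) - h (s, x0)| <= e.
have /compact_near_coveringP/(_ E (nbhs x0) P _) covP :
  compact `[(0 : R), 1] by exact: segment_compact.
apply: filterS (covP _) => [x Px s s01|].
  by apply: Px; rewrite /= in_itv.
move=> s _; have /cvgrPdist_le/(_ _ e20)/nbhs_normP[d /= d0 hd] := ch (s, x0).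
  exists ([set r | `|s - r| < d], [set x | `|x0 - x| < d]) => /=.
    by split; apply/nbhs_normP; exists d.
  move=> [r x] /= [rd xd].
  have h1 : `|h (s, x0) - h (r, x)| <= e / 2.
    by apply: hd; rewrite /= prod_normE /= gt_max rd.
  have h2 : `|h (s, x0) - h (r, x0)| <= e / 2.
    by apply: hd; rewrite /= prod_normE /= gt_max rd subrr normr0.
  rewrite /P; have -> : h (r, x) - h (r, x0) =
      (h (s, x0) - h (r, x0)) - (h (s, x0) - h (r, x)).
    by rewrite opprB [RHS]addrC addrA subrK.
  by apply: le_trans (ler_normB _ _) _; move: h1 h2; lra.
Qed.

(** The tube lemma for [(s, u) |-> c (s + u)] near [u = 0] gives uniform continuity on [[0, 1]]. *)
Lemma uniform_near_step V (c : R -> V) (e : R) : continuous c -> 0 < e ->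
  \forall n \near \oo, forall s u : R,
    0 <= s <= 1 -> 0 <= u <= n%:R^-1 -> `|c (s + u) - c s| <= e.
Proof.
move=> cc e0.
have ch : continuous (fun p : (R * R)%type => c (p.1 + p.2)).
  move=> p; apply: (continuous_comp (f := fun p : (R * R)%type => p.1 + p.2)).
    exact: add_continuous.
  exact: cc.
have := @uniform_near_segment _ _ _ 0 e ch e0.
move=> /nbhs_norm0P[d /= d0 hd].
have := near_infty_natSinv_lt (PosNum d0).
(* The known bound concerns the inverse of [n.+1], hence the shift by one, which also discards
   [n = 0]. *)
move=> [N _ hN]; exists N.+1 => // -[//|n] /= /ltnSE Nn s u s01 /andP[u0 un].
have /= := hd u _ s s01; rewrite addr0; apply.
by rewrite ger0_norm //; apply: le_lt_trans un _; exact: hN.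
Qed.

Definition riemann_sum V (c : R -> V) (n : nat) : V :=
  n%:R^-1 *: \sum_(0 <= k < n) c (k%:R / n%:R).

(** The integral over [[0, 1]] as a limit of left-endpoint sums; [lim] is meaningful where these
    converge. *)
Definition riemann V (c : R -> V) : V := lim (riemann_sum c n @[n --> \oo]).

Lemma norm_mean_le V (F : nat -> V) (n : nat) (e : R) : (0 < n)%N ->
  (forall k, (k < n)%N -> `|F k| <= e) ->
  `|n%:R^-1 *: \sum_(0 <= k < n) F k| <= e.
Proof.
move=> n0 Fe; rewrite normrZ ger0_norm ?invr_ge0 ?ler0n //.
rewrite mulrC ler_pdivrMr ?ltr0n //.
apply: le_trans (ler_norm_sum _ _ _) _.
rewrite -[n in leRHS]subn0 mulr_natr -sumr_const_nat !big_nat.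
by apply: ler_sum => k /andP[_ kn]; exact: Fe.
Qed.

Lemma ratio_01 (k n : nat) : (k <= n)%N -> 0 <= (k%:R / n%:R : R) <= 1.
Proof.
move=> kn; rewrite divr_ge0 ?ler0n //=.
have [->|n0] := posnP n; first by rewrite invr0 mulr0.
by rewrite ler_pdivrMr ?ltr0n // mul1r ler_nat.
Qed.

(** Group the [n * m] nodes into [n] blocks of [m]: each node lies within [1 / n] of the left end of
    its block, whose value represents the block in the coarse sum. *)
Lemma riemann_sum_refine V (c : R -> V) (n m : nat) (e : R) :
  (0 < n)%N -> (0 < m)%N ->
  (forall s u : R, 0 <= s <= 1 -> 0 <= u <= n%:R^-1 -> `|c (s + u) - c s| <= e) ->
  `|riemann_sum c (n * m) - riemann_sum c n| <= e.
Proof.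
move=> n0 m0 ce.
have nN0 : n%:R != 0 :> R by rewrite pnatr_eq0 -lt0n.
have mN0 : m%:R != 0 :> R by rewrite pnatr_eq0 -lt0n.
have -> : riemann_sum c (n * m) - riemann_sum c n = n%:R^-1 *:
    \sum_(0 <= k < n) (m%:R^-1 *:
      \sum_(0 <= j < m) (c (k%:R / n%:R + j%:R / (n * m)%:R) - c (k%:R / n%:R))).
  rewrite /riemann_sum natrM invfM -scalerA -scalerBr; congr (_ *: _).
  rewrite big_nat_mul scaler_sumr -sumrB; apply: eq_bigr => k _.
  rewrite sumrB scalerBr sumr_const_nat subn0 -[c (k%:R / n%:R) *+ m]scaler_nat.
  rewrite scalerA mulVf // scale1r.
  congr (_ *: _ - _).
  rewrite -{1}[(k * m)%N]add0n mulSn big_addn addnK; apply: eq_bigr => j _.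
  by congr c; rewrite natrD !natrM; field; rewrite mN0 nN0.
apply: norm_mean_le => // k kn; apply: norm_mean_le => // j jm.
apply: ce; first by apply: ratio_01; exact: ltnW.
have /andP[j0 j1] := @ratio_01 j m (ltnW jm).
have n10 : 0 <= n%:R^-1 :> R by rewrite invr_ge0 ler0n.
have -> : j%:R / (n * m)%:R = n%:R^-1 * (j%:R / m%:R) :> R.
  by rewrite natrM; field; rewrite mN0 nN0.
by rewrite mulr_ge0 //= ler_piMr.
Qed.

(** Sums with [N.+1] and [n] nodes are both compared with their common refinement, so the sums are
    Cauchy. *)
Lemma cvg_riemann V (c : R -> V) : banach V -> continuous c ->
  riemann_sum c n @[n --> \oo] --> riemann c.
Proof.
move=> bV cc; apply: bV; apply: cauchy_exP => e e0.
have e30 : 0 < e / 3 by rewrite divr_gt0.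
have [N _ hN] := uniform_near_step cc e30.
exists (riemann_sum c N.+1), N.+1 => // n /= Nn.
have n0 : (0 < n)%N by exact: leq_trans Nn.
have h1 : `|riemann_sum c (N.+1 * n) - riemann_sum c N.+1| <= e / 3.
  by apply: riemann_sum_refine => //; apply: hN => /=.
have h2 : `|riemann_sum c (N.+1 * n) - riemann_sum c n| <= e / 3.
  by rewrite mulnC; apply: riemann_sum_refine => //; apply: hN; exact: ltnW.
rewrite -ball_normE /=.
have -> : riemann_sum c N.+1 - riemann_sum c n =
  (riemann_sum c (N.+1 * n) - riemann_sum c n) -
  (riemann_sum c (N.+1 * n) - riemann_sum c N.+1).
  by rewrite opprB [RHS]addrC addrA subrK.
by apply: le_lt_trans (ler_normB _ _) _; move: h1 h2; lra.
Qed.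

Lemma riemann_linear V (c d : R -> V) (a : R) :
  banach V -> continuous c -> continuous d ->
  riemann (fun s => a *: c s + d s) = a *: riemann c + riemann d.
Proof.
move=> bV cc cd; apply: cvg_lim => //.
apply: (cvg_trans _ (cvgD (cvgZ (cvg_cst a) (cvg_riemann bV cc))
  (cvg_riemann bV cd))).
apply: near_eq_cvg; apply: nearW => n.
rewrite -[LHS]/(a *: riemann_sum c n + riemann_sum d n) /riemann_sum.
by rewrite scalerA mulrC -scalerA -scalerDr scaler_sumr -big_split.
Qed.

Lemma riemann_le V (c : R -> V) (M : R) : banach V -> continuous c ->
  (forall s, 0 <= s <= 1 -> `|c s| <= M) -> `|riemann c| <= M.
Proof.
move=> bV cc cM; apply/ler_addgt0Pr => e e0.
have /cvgrPdist_le/(_ _ e0)[N _ /(_ N.+1)/= hN] := cvg_riemann bV cc.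
have {}hN := hN (leqnSn _).
rewrite -(subrK (riemann_sum c N.+1) (riemann c)) addrC.
apply: le_trans (ler_normD _ _) _; apply: lerD => //.
by apply: norm_mean_le => // k kn; apply: cM; apply: ratio_01; exact: ltnW.
Qed.

Lemma riemann_cst V (v : V) : riemann (fun=> v) = v.
Proof.
apply: cvg_lim => //; apply: cvg_near_cst.
(* The sum for [n = 0] is zero, so constancy starts at 1. *)
exists 1%N => // n /= n0.
rewrite /riemann_sum sumr_const_nat subn0 -[v *+ n]scaler_nat scalerA mulVf ?scale1r //.
by rewrite pnatr_eq0 -lt0n.
Qed.

(** The increment of [c] telescopes over the nodes [k / n]. By the mean value inequality and uniform
    continuity each piece differs from ['D_1 c (k / n) / n] by at most [e / n]. *)
Lemma riemann_derive V (c : R -> V) : (forall t, derivable c t 1) ->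
  continuous (fun t => 'D_1 c t) -> riemann (fun t => 'D_1 c t) = c 1 - c 0.
Proof.
move=> dc cc; apply: cvg_lim => //; apply/cvgrPdist_le => e e0.
have [N _ hN] := uniform_near_step cc e0.
exists N.+1 => // n /= Nn; have n0 : (0 < n)%N by exact: leq_trans Nn.
have nN0 : n%:R != 0 :> R by rewrite pnatr_eq0 -lt0n.
have -> : c 1 - c 0 - riemann_sum (fun t => 'D_1 c t) n =
    n%:R^-1 *: \sum_(0 <= k < n) (n%:R *:
      (c (n%:R^-1 *: 1 + k%:R / n%:R) - c (k%:R / n%:R)
        - n%:R^-1 *: 'D_1 c (k%:R / n%:R))).
  rewrite -scaler_sumr scalerA mulVf // scale1r sumrB -scaler_sumr.
  congr (_ - _).
  transitivity (\sum_(0 <= k < n) (c (k.+1%:R / n%:R) - c (k%:R / n%:R))).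
    by rewrite telescope_sumr // mul0r divff.
  apply: eq_bigr => k _; rewrite -[n%:R^-1 *: 1]/(n%:R^-1 * 1) mulr1.
  by rewrite (addrC n%:R^-1) -natr1 mulrDl mul1r.
apply: norm_mean_le => // k kn; rewrite normrZ ger0_norm ?ler0n //.
rewrite mulrC -ler_pdivlMr ?ltr0n // -[n%:R^-1 in leRHS]ger0_norm ?invr_ge0 ?ler0n //.
apply: segment_mean_valueZ => // s /andP[s0 s1].
rewrite [s *: _ + _]addrC; apply: (hN n (ltnW Nn)); first by apply: ratio_01; exact: ltnW.
have n10 : 0 <= n%:R^-1 :> R by rewrite invr_ge0 ler0n.
by rewrite -[s *: _]/(s * (n%:R^-1 * 1)) mulr1 mulr_ge0 //= ler_piMl.
Qed.

End RiemannIntegral.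

(** * Smooth dependence of integrals on parameters *)

Section ParametricIntegral.
Variable R : realType.
Implicit Types (E V : normedModType R).

Lemma riemannB_le V (c d : R -> V) (M : R) :
  banach V -> continuous c -> continuous d ->
  (forall s, 0 <= s <= 1 -> `|c s - d s| <= M) ->
  `|riemann c - riemann d| <= M.
Proof.
move=> bV cc cd cdM.
have -> : riemann c - riemann d = riemann (fun s => (-1) *: d s + c s).
  by rewrite riemann_linear // scaleN1r addrC.
apply: riemann_le => // [s|s s01]; last by rewrite scaleN1r addrC cdM.
by apply: cvgD; [apply: cvgZ; [exact: cst_continuous | exact: cd] | exact: cc].
Qed.

(** Differentiation under the integral sign: near [x] the partial derivative stays within [e] of its
    value at [x], uniformly in [s]. The mean value inequality in direction [(0, v)] then bounds the
    remainder of the integrand, and integration preserves the bound. *)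
Lemma is_derive_riemann E V (h : (R * E)%type -> V) (x v : E) :
  banach V -> smooth_n 1 h ->
  is_derive x v (fun y => riemann (fun s => h (s, y)))
    (riemann (fun s => 'D_((0, v) : (R * E)%type) h (s, x))).
Proof.
move=> bV [dh cDh]; have ch := smooth1_continuous dh cDh.
pose K := fun p : (R * E)%type => 'D_((0, v) : (R * E)%type) h p.
have cK : continuous K.
  have -> : K = fun p => (fun q : (R * E * (R * E))%type => 'D_(q.2) h q.1)
    ((fun p => (p, (0, v) : (R * E)%type)) p) by [].
  apply: (@smooth_n_comp _ _ _ _ 0) cDh.
  apply: (@smooth_n_pair _ _ _ _ 0) => [p|]; first exact: cvg_id.
  exact: smooth_n_cst.
apply/is_derive_distP => e e0.
have /nbhs_normP[d /= d0 hd] := uniform_near_segment x cK e0.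
have v0 : 0 < `|v| + 1 by rewrite ltr_wpDl.
apply/nbhs_norm0P; exists (d / (`|v| + 1)) => /=; first exact: divr_gt0.
move=> t /=; rewrite ltr_pdivlMr // => td.
rewrite -addrA -opprD addrC.
have cs y : continuous (fun s => h (s, y)) by exact: continuous_slice.
have cKs : continuous (fun s => K (s, x)) by exact: continuous_slice.
(* Linearity merges the value at [x] and the linear term into one integral, so the remainder is a
   difference of two integrals. *)
rewrite addrC -(addrC (t *: _)) -riemann_linear //.
apply: riemannB_le => // [s|s s01].
  by apply: cvgD; [apply: cvgZ; [exact: cst_continuous | exact: cKs] | exact: cs].
rewrite opprD addrA addrAC.
have -> : (s, t *: v + x) = t *: ((0, v) : (R * E)%type) + (s, x).
  by rewrite -[RHS]/(t *: 0 + s, t *: v + x) scaler0 add0r.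
apply: segment_mean_valueZ => [y|r /andP[r0 r1]]; first exact: dh.
have -> : r *: (t *: ((0, v) : (R * E)%type)) + (s, x) =
    (s, r *: (t *: v) + x).
  by rewrite -[LHS]/(r *: (t *: 0) + s, r *: (t *: v) + x) !scaler0 add0r.
apply: (hd (r *: (t *: v) + x)) => //=.
rewrite opprD addrCA subrr addr0 normrN !normrZ (ger0_norm r0).
apply: le_lt_trans td; apply: (@le_trans _ _ (`|t| * `|v|)).
  by rewrite ler_piMl // mulr_ge0.
by rewrite ler_wpM2l // lerDl.
Qed.

(** The derivative is again a parametric integral, with parameter space [E * E], hence the induction
    over all [E]. *)
Lemma smooth_n_riemann E V (h : (R * E)%type -> V) (n : nat) :
  banach V -> smooth_n n h ->
  smooth_n n (fun x => riemann (fun s => h (s, x))).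
Proof.
move=> bV; elim: n E h => [|n IHn] E h.
  move=> ch x; apply/cvgrPdist_le => e e0.
  apply: filterS (uniform_near_segment x ch e0) => y hy.
  rewrite distrC; apply: riemannB_le => //; exact: continuous_slice.
move=> [dh sDh].
apply: (@smooth_nS _ _ _ _ _ (fun p : (E * E)%type =>
  riemann (fun s => 'D_((0, p.2) : (R * E)%type) h (s, p.1)))) => [x v|].
  by apply: is_derive_riemann => //; split=> //; exact: smooth_n_continuous sDh.
apply: (IHn _ (fun q : (R * (E * E))%type =>
  'D_((0, q.2.2) : (R * E)%type) h (q.1, q.2.1))).
apply: (@smooth_n_comp _ _ _ _ _ (fun q : (R * (E * E))%type =>
  ((q.1, q.2.1), (0, q.2.2)) : ((R * E) * (R * E))%type) _ _ sDh).
have s21 : smooth_n n (fun q : (R * (E * E))%type => q.2.1).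
  exact: smooth_n_comp (smooth_n_snd _ _ _) (smooth_n_fst _ _ _).
have s22 : smooth_n n (fun q : (R * (E * E))%type => q.2.2).
  exact: smooth_n_comp (smooth_n_snd _ _ _) (smooth_n_snd _ _ _).
apply: smooth_n_pair; apply: smooth_n_pair => //.
  exact: smooth_n_fst.
exact: smooth_n_cst.
Qed.

End ParametricIntegral.

(** * The product space and the deformation of the tangent lift *)

Lemma banach_prod (R : realType) (U V : normedModType R) :
  banach U -> banach V -> banach (U * V)%type.
Proof.
move=> bU bV F FF /cauchyP cF.
have c1 : cauchy (fst @ F).
  apply: cauchy_exP => e /cF [[x y] Fxy]; exists x.
  by apply: (@filterS _ F _ _ (fst @^-1` ball x e) _ Fxy) => p [].
have c2 : cauchy (snd @ F).
  apply: cauchy_exP => e /cF [[x y] Fxy]; exists y.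
  by apply: (@filterS _ F _ _ (snd @^-1` ball y e) _ Fxy) => p [].
have F1 : fst @ F --> lim (fst @ F) by exact: bU.
have F2 : snd @ F --> lim (snd @ F) by exact: bV.
apply/cvg_ex; exists (lim (fst @ F), lim (snd @ F)).
apply: (cvg_trans _ (cvg_pair F1 F2)) => A FA.
by apply: (@filterS _ F _ _ _ _ FA) => p; rewrite /preimage /= -surjective_pairing.
Qed.

Section DifferenceQuotient.
Variables (R : realType) (Y : normedModType R) (f : Y -> Y).
Hypotheses (bY : banach Y) (sf : smooth f).

Definition difference_quotient (t : R) (p : (Y * Y)%type) : Y :=
  riemann (fun s : R => 'D_(p.2) f (s *: (t *: p.2) + p.1)).

(** The family [g_t] as a single map, so that smoothness in [t] and in the point is joint. *)
Definition deformed_lift (q : (R * (Y * Y))%type) : (Y * Y)%type :=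
  (f q.2.1, difference_quotient q.1 q.2).

(** The fundamental theorem of calculus along the segment from [p.1] to [t *: p.2 + p.1]. *)
Lemma difference_quotientE t p :
  t *: difference_quotient t p = f (t *: p.2 + p.1) - f p.1.
Proof.
have [df cDf] : smooth_n 1 f by exact: sf.
pose c (s : R) := f (s *: (t *: p.2) + p.1).
have dc s : is_derive s (1 : R) c ('D_(t *: p.2) f (s *: (t *: p.2) + p.1)).
  exact: is_derive_line.
(* The added [0] is a constant curve that gives the integrand the shape of [riemann_linear]. *)
have DcE : (fun s : R => 'D_1 c s) =
    fun s => t *: 'D_(p.2) f (s *: (t *: p.2) + p.1) + 0.
  apply/funext => s; rewrite (@derive_val _ _ _ _ _ _ _ (dc s)) addr0.
  exact: @derive_val _ _ _ _ _ _ _ (is_derive_dirZ t (derivableP (df _ _))).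
have cD : continuous (fun s : R => 'D_(p.2) f (s *: (t *: p.2) + p.1)).
  apply: (@smooth_n_comp _ _ _ _ 0 (fun s : R =>
    (s *: (t *: p.2) + p.1, p.2) : (Y * Y)%type) _ _ cDf).
  apply: smooth_n_pair; last exact: smooth_n_cst.
  apply: smooth_n_add; last exact: smooth_n_cst.
  by apply: smooth_n_scale; [move=> s; exact: cvg_id | exact: smooth_n_cst].
have := @riemann_derive R Y c.
rewrite DcE riemann_linear //; last by move=> s; exact: cst_continuous.
rewrite riemann_cst addr0 /c scale1r scale0r add0r; apply.
  by move=> s; exact: ex_derive.
move=> s; apply: cvgD; last exact: cst_continuous.
by apply: cvgZ; [exact: cst_continuous | exact: cD].
Qed.

Lemma deformed_lift0 : (fun p => deformed_lift (0, p)) = tangent_lift f.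
Proof.
apply/funext => p; rewrite /deformed_lift /tangent_lift /difference_quotient /=.
by under eq_fun do rewrite scale0r scaler0 add0r; rewrite riemann_cst.
Qed.

Lemma smooth_deformed_lift : smooth deformed_lift.
Proof.
move=> n; have s2 := @smooth_n_snd R R (Y * Y)%type n.
apply: smooth_n_pair.
  exact: smooth_n_comp (smooth_n_comp s2 (smooth_n_fst _ _ _)) (sf n).
(* Here [z] stands for [(s, (t, (y, eta)))]; the integrand is the derivative of [f] after a
   polynomial map of [z]. *)
apply: (@smooth_n_riemann R (R * (Y * Y))%type Y
  (fun z => 'D_(z.2.2.2) f (z.1 *: (z.2.1 *: z.2.2.2) + z.2.2.1))) => //.
have [_ sDf] := sf n.+1.
have z1 := @smooth_n_fst R R (R * (Y * Y))%type n.
have z2 := @smooth_n_snd R R (R * (Y * Y))%type n.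
have z21 := smooth_n_comp z2 (smooth_n_fst _ _ _).
have z22 := smooth_n_comp z2 s2.
have z221 := smooth_n_comp z22 (smooth_n_fst _ _ _).
have z222 := smooth_n_comp z22 (smooth_n_snd _ _ _).
apply: (@smooth_n_comp _ _ _ _ _ (fun z : (R * (R * (Y * Y)))%type =>
  (z.1 *: (z.2.1 *: z.2.2.2) + z.2.2.1, z.2.2.2) : (Y * Y)%type) _ _ sDf).
apply: smooth_n_pair => //; apply: smooth_n_add => //.
by apply: smooth_n_scale => //; exact: smooth_n_scale.
Qed.

Lemma smooth_deformed_lift_at t : smooth (fun p => deformed_lift (t, p)).
Proof.
move=> n; apply: (@smooth_n_comp _ _ _ _ _ (fun p : (Y * Y)%type =>
  (t, p) : (R * (Y * Y))%type) _ _ (smooth_deformed_lift n)).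
apply: smooth_n_pair; first exact: smooth_n_cst.
by apply: smooth_n_affine; exists id, 0; split=> //; split=> [p|p];
  [exact: cvg_id | rewrite addr0].
Qed.

End DifferenceQuotient.

(** * Equivariance under linear maps and passage to the limit *)

Lemma derive_linear (R : realType) (Y U : normedModType R) (L : Y -> U) (y v : Y) :
  (forall (a : R) (x z : Y), L (a *: x + z) = a *: L x + L z) -> 'D_v L y = L v.
Proof.
move=> linL; have := @derive_val _ _ _ _ _ _ _ (is_derive_linear 0 y v linL).
by under eq_fun do rewrite addr0.
Qed.

(** A continuous linear map is its own derivative, so relatedness becomes plain intertwining. *)
Lemma equivariant_linear (R : realType) (phi : int_map R)
    (Y U : normedModType R) (L : Y -> U) (f : Y -> Y) (g : U -> U) :
  affine_equivariant phi -> banach Y -> banach U ->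
  (forall (a : R) (x z : Y), L (a *: x + z) = a *: L x + L z) ->
  continuous L -> smooth f -> smooth g ->
  (forall y, L (f y) = g (L y)) ->
  forall y, L (phi Y f y) = phi U g (L y).
Proof.
move=> eqphi bY bU linL cL sf sg Lfg y.
rewrite -(derive_linear y _ linL); apply: eqphi => //.
  by exists L, 0; split=> //; split=> // z; rewrite addr0.
by move=> z; rewrite derive_linear.
Qed.

Theorem theorem2p13 (R : realType) (phi : int_map R) :
  integrator_map phi -> affine_equivariant phi ->
  forall (Y : normedModType R), banach Y ->
  forall f : Y -> Y, smooth f ->
    phi (Y * Y)%type (tangent_lift f) = tangent_lift (phi Y f).
Proof.
move=> iphi eqphi Y bY f sf; apply/funext => -[y eta].
have bYY := banach_prod bY bY.
pose G (t : R) := phi (Y * Y)%type (fun p => deformed_lift f (t, p)).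
have sG := smooth_deformed_lift_at bY sf.
have G1 t p : (G t p).1 = phi Y f p.1.
  by apply: (equivariant_linear (L := fst) eqphi) => // q; exact: cvg_fst.
have G2 t p : t *: (G t p).2 + (G t p).1 = phi Y f (t *: p.2 + p.1).
  apply: (equivariant_linear (L := fun q : (Y * Y)%type => t *: q.2 + q.1) eqphi)
    => // [a q r|q|q] /=.
  - by rewrite !scalerDr !scalerA (mulrC t) addrACA.
  - apply: cvgD; last exact: cvg_fst.
    by apply: cvgZ; [exact: cst_continuous | exact: cvg_snd].
  - by rewrite difference_quotientE // subrK.
(* Order 0 of the smoothness of [phi] along the family [deformed_lift f] gives joint continuity,
   used on the slice at [(y, eta)]. *)
have cG : (G t (y, eta)) @[t --> (0 : R)^'] --> G 0 (y, eta).
  have cG := continuous_slice (x := (y, eta))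
    ((iphi _ bYY).2 _ (smooth_deformed_lift bY sf) 0%N).
  exact: (continuous_withinNx _ _).1 (cG 0).
have [dphif _] : smooth_n 1 (phi Y f) by exact: (iphi _ bY).1.
(* For [t <> 0], [G1] and [G2] determine both components of [G t]; the second is the difference
   quotient of [phi Y f]. *)
have cD : (G t (y, eta)) @[t --> (0 : R)^'] --> tangent_lift (phi Y f) (y, eta).
  have /is_deriveP d2 := derivableP (dphif y eta).
  apply: (cvg_trans _ (cvg_pair (cvg_cst (phi Y f y)) d2)).
  apply: near_eq_cvg; rewrite near_withinE; apply: nearW => t t0 /=.
  rewrite -(G2 t (y, eta)) -(G1 t (y, eta)) addrK scalerA mulVf // scale1r.
  by rewrite -surjective_pairing.
rewrite -(deformed_lift0 f); exact: cvg_unique cG cD.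
Qed.
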